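(* Every real number $\delta\le 0.9808348$ is admissible.
   Context: A polynomial $p(s)\in\mathbb{R}[s]$ is stable if every complex root $t$ of $p$ satisfies $\mathrm{Re}(t)<0$. (Nonzero constants are stable; the zero polynomial is not.) Let $H$ be the set of stable polynomials in $\mathbb{R}[s]$. A real number $\delta$ is admissible if there exist $x,y\in H$ with $\deg(x)\ge\deg(y)$ such that $(s^2-2\delta s+1)x(s)+(s^2-1)y(s)\in H$. *)

(* Defs.v *)
From mathcomp Require Import all_boot all_order all_algebra.
From mathcomp Require Import complex reals.

Set Implicit Arguments.
Unset Strict Implicit.
Unset Printing Implicit Defensive.

Import Order.TTheory GRing.Theory Num.Theory.

Local Open Scope ring_scope.
Local Open Scope complex_scope.

Section Stability.

Variable R : realType.

(* The zero polynomial is not stable (see [stable_neq0]): 0 is a root of it. *)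
Definition stable (p : {poly R}) : Prop :=
  forall t : R[i], root (map_poly (real_complex R) p) t -> complex.Re t < 0.

Lemma stable_neq0 (p : {poly R}) : stable p -> p != 0.
Proof.
move=> sp; apply/eqP => p0; have := sp 0.
by rewrite p0 rmorph0 root0 ltxx => /(_ isT).
Qed.

Lemma stableC (c : R) : c != 0 -> stable c%:P.
Proof.
by move=> c0 t; rewrite map_polyC rootC /= fmorph_eq0 (negPf c0).
Qed.

(* By [stable_neq0], x and y are nonzero, so comparing sizes is the same as
   comparing degrees. *)
Definition admissible (delta : R) : Prop :=
  exists x y : {poly R},
    [/\ stable x, stable y, (size y <= size x)%N
      & stable (('X^2 - (2 * delta) *: 'X + 1) * x + ('X^2 - 1) * y)].

End Stability.

(* Main.v *)
From Stdlib Require Import BinInt.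
Require Import Defs.
From mathcomp Require Import all_boot all_order all_algebra.
From mathcomp Require Import complex reals.
From mathcomp Require Import ring lra zify ssrZ.

(** The proof splits into a transport argument, which reduces all the values
of delta to the single value delta0 = 0.9808348, and one explicit pair of
polynomials for delta0.

Transport.  For a > 0 and b >= 0 the map s |-> (a s + b) / (b s + a) sends the
closed right half-plane into itself.  Substituting it into s^2 - 2 delta0 s + 1
and s^2 - 1, and clearing denominators, gives multiples of
s^2 - 2 delta s + 1 and of s^2 - 1, where delta moves continuously from delta0
at b = 0 down to -1 at b = a.  So the substitution turns a solution (x, y) for
delta0 into one for any delta in ]-1, delta0] ([admissible_le]).  In the disc
coordinate w = (s - 1) / (s + 1) this is only a contraction w |-> r w.  For
delta < 0 constants x and y are enough ([admissible_neg]), because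
s^2 - 2 delta s + 1 is then stable itself.

The pair for delta0.  Here x and y have degree 33 and integer coefficients
([x_coefs], [y_coefs]), and z = (s^2 - 2 delta0 s + 1) x + (s^2 - 1) y has
degree 35.  They are the rounding of a numerical solution of an extremal
problem: in the coordinate w the three polynomials should be zero-free in a
disc around 0 that is as large as possible compared with the modulus of the
roots of s^2 - 2 delta0 s + 1.

Stability of x, y, z.  The Hermite-Biehler theorem is used: p is written as
E(s^2) + s O(s^2), and p is stable as soon as the roots of E and O are negative
and interlace, the largest one belonging to E ([stable_interlacing]).  Indeed
E / O then has a partial fraction expansion a/b + sum_k r_k / (u - o_k) with
all r_k < 0, so that Im (E(u) / O(u)) has the sign of Im u; at a root t of p
with u = t^2 one has E(u) / O(u) = - t, while Im u = 2 Re t Im t, which is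
impossible when Re t > 0.  Interlacing in turn follows from the
intermediate value theorem and a count of roots, once sign changes of E and of
O are exhibited alternately between consecutive points of a decreasing list of
nonpositive rationals ([stable_sign_changes]).  These signs are computed in
integer arithmetic ([stability_test]). *)

Set Implicit Arguments.
Unset Strict Implicit.
Unset Printing Implicit Defensive.

Import Order.TTheory GRing.Theory Num.Theory.

Local Open Scope ring_scope.

(* A separate key for binary integers, as Z is also the key of the scope of int. *)
Delimit Scope Z_scope with bZ.

(** * Partial fractions with interlacing roots *)

(** The residue at u = o k of the quotient of the two products
prod_i (u - e i) and prod_i (u - o i). *)
Definition residue (F : fieldType) m (e o : 'I_m -> F) (k : 'I_m) : F :=
  \prod_i (o k - e i) / \prod_(i | i != k) (o k - o i).

Lemma horner_prod_XsubC (F : comNzRingType) (I : finType) (Q : pred I)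
    (f : I -> F) (u : F) :
  (\prod_(i | Q i) ('X - (f i)%:P)).[u] = \prod_(i | Q i) (u - f i).
Proof. by rewrite horner_prod; apply: eq_bigr => i _; rewrite hornerXsubC. Qed.

(** The difference of the two sides, multiplied by prod_i (u - o i), is a
polynomial of degree less than m in u, because the two products are monic of
degree m; it vanishes at the m points o k, so it is zero. *)
Lemma partial_fractions (F : fieldType) m (e o : 'I_m -> F) (u : F) :
  injective o -> (forall k, u != o k) ->
  \prod_i (u - e i) =
    \prod_i (u - o i) * (1 + \sum_k residue e o k / (u - o k)).
Proof.
move=> o_inj uo.
pose P := \prod_i ('X - (e i)%:P) - \prod_i ('X - (o i)%:P)
  - \sum_k residue e o k *: \prod_(i | i != k) ('X - (o i)%:P).
have sz f : size (\prod_(i < m) ('X - (f i : F)%:P)) = m.+1.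
  by rewrite -[RHS](congr1 S (size_enum_ord m)) -(size_prod_XsubC _ f) big_enum.
have lc f : (\prod_(i < m) ('X - (f i : F)%:P))`_m = 1.
  have /monicP := monic_prod_XsubC (index_enum 'I_m) predT f.
  by rewrite lead_coefE sz.
have szk k : size (\prod_(i | i != k) ('X - (o i)%:P)) = m.
  have := sz o; rewrite (bigD1 k) //= size_monicM ?monicXsubC //; last first.
    by rewrite monic_neq0 ?monic_prod_XsubC.
  by rewrite size_XsubC => -[].
have Pu v : P.[v] = \prod_i (v - e i) - \prod_i (v - o i)
    - \sum_k residue e o k * \prod_(i | i != k) (v - o i).
  rewrite !hornerD !hornerN !horner_prod_XsubC horner_sum.
  congr (_ - _); apply: eq_bigr => k _.
  by rewrite hornerZ horner_prod_XsubC.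
have P0 : P = 0.
  apply: (@roots_geq_poly_eq0 _ P [seq o i | i <- enum 'I_m]).
  - apply/allP => _ /mapP[k _ ->]; rewrite rootE Pu.
    rewrite [X in _ - X - _](bigD1 k) //= subrr mul0r subr0.
    rewrite [X in _ - X](bigD1 k) //= [X in _ - (_ + X)]big1 ?addr0; last first.
      by move=> i ik; rewrite [X in _ * X](bigD1 k) 1?eq_sym //= subrr mul0r mulr0.
    rewrite divfK ?subrr //; apply/prodf_neq0 => i ik.
    by rewrite subr_eq0 (inj_eq o_inj) eq_sym.
  - by rewrite map_inj_uniq ?enum_uniq.
  - rewrite size_map size_enum_ord; apply/leq_sizeP => j mj.
    rewrite !coefB coef_sum [X in _ - X]big1 ?subr0; last first.
      by move=> k _; rewrite coefZ nth_default ?mulr0 ?szk.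
    move: mj; rewrite leq_eqVlt => /predU1P[<-|mj]; first by rewrite !lc subrr.
    by rewrite !nth_default ?sz ?subr0.
move/eqP: (Pu u); rewrite P0 horner0 eq_sym -addrA -opprD subr_eq0 => /eqP ->.
rewrite mulrDr mulr1 mulr_sumr; congr (_ + _); apply: eq_bigr => k _.
rewrite [X in _ = X * _](bigD1 k) //=.
by field; rewrite subr_eq0.
Qed.

Section HermiteBiehler.
Variable R : realType.
Local Open Scope complex_scope.

(** Pairing (o k - e i) with (o k - o i) for i != k gives positive ratios, as
e i and o i lie on the same side of o k; the factor that is left, o k - e k, is
negative. *)
Lemma residue_lt0 m (e o : 'I_m -> R) (k : 'I_m) :
  (forall i j : 'I_m, (i <= j)%N -> o j < e i) ->
  (forall i j : 'I_m, (i < j)%N -> e j < o i) ->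
  residue e o k < 0.
Proof.
move=> oe eo; rewrite /residue (bigD1 k) //= -mulrA -prodf_div.
rewrite nmulr_rlt0 ?subr_lt0 ?oe //; apply: prodr_gt0 => i ik.
have [ik'|ki] := ltnP i k.
  rewrite -mulrNN -invrN !opprB divr_gt0 // subr_gt0 ?oe ?(ltnW ik') //.
  by apply: lt_trans (eo _ _ ik'); exact: oe.
have {ki}ki : (k < i)%N by rewrite ltn_neqAle ki andbT; apply: contra ik => /eqP/val_inj->.
rewrite divr_gt0 ?subr_gt0 ?eo //.
by apply: lt_trans (eo _ _ ki); exact: oe.
Qed.

Lemma Im_simple_fraction (r o : R) (u : R[i]) : u != o%:C ->
  exists2 T, 0 < T & complex.Im (r%:C / (u - o%:C)) = - (r * complex.Im u * T).
Proof.
case: u => x y; rewrite eq_complex /= => uo.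
exists (((x - o) ^+ 2 + y ^+ 2)^-1).
  rewrite invr_gt0; have [y0|y0] := eqVneq y 0.
    by rewrite y0 expr0n addr0 exprn_even_gt0 //= subr_eq0; move: uo; rewrite y0 eqxx andbT.
  by rewrite ltr_wpDl ?sqr_ge0 // exprn_even_gt0.
by simpc; rewrite /= mulrA.
Qed.

(** * The Hermite-Biehler criterion *)

Lemma stableP (p : {poly R}) :
  (forall t : R[i], 0 <= complex.Re t -> (map_poly (real_complex R) p).[t] != 0) ->
  stable p.
Proof. by move=> np t pt; rewrite ltNge; apply: contraL pt => /np. Qed.

Lemma stableN0 (p : {poly R}) (t : R[i]) :
  stable p -> 0 <= complex.Re t -> (map_poly (real_complex R) p).[t] != 0.
Proof. by move=> sp; rewrite leNgt; apply: contra => /sp. Qed.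

(** Let u = t^2 with Re t >= 0.  If u is not real, comparing imaginary parts in
E(u) / O(u) = - t contradicts the sign of the residues.  If u is real, then
either t is real, and E(u) > 0 and O(u) > 0 since u >= 0; or t is imaginary and
nonzero, so that E(u) is real and t O(u) imaginary: both would vanish, but
E and O have no common root. *)
Lemma stable_interlacing m (e o : 'I_m -> R) (a b : R) :
  0 < a -> 0 < b -> (forall i, e i < 0) ->
  (forall i j : 'I_m, (i <= j)%N -> o j < e i) ->
  (forall i j : 'I_m, (i < j)%N -> e j < o i) ->
  stable ((a *: \prod_i ('X - (e i)%:P)) \Po 'X^2
          + ((b *: \prod_i ('X - (o i)%:P)) \Po 'X^2) * 'X).
Proof.
move=> a0 b0 e0 oe eo; apply: stableP => t t0.
have o0 i : o i < 0 by apply: lt_trans (e0 i); exact: oe.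
have eNo i j : e i != o j.
  have [ij|ji] := leqP i j; first by rewrite gt_eqF ?oe.
  by rewrite lt_eqF ?eo.
have o_inj : injective o.
  move=> i j oij; apply: val_inj; case: (ltngtP i j) => // ij.
    by have := lt_trans (oe _ _ (leqnn j)) (eo _ _ ij); rewrite oij ltxx.
  by have := lt_trans (oe _ _ (leqnn i)) (eo _ _ ij); rewrite oij ltxx.
pose u := t ^+ 2.
have horner_half c (f : 'I_m -> R) :
    (map_poly (real_complex R) ((c *: \prod_i ('X - (f i)%:P)) \Po 'X^2)).[t]
    = c%:C * \prod_i (u - (f i)%:C).
  rewrite map_comp_poly horner_comp map_polyXn hornerXn map_polyZ hornerZ.
  rewrite rmorph_prod /= -horner_prod_XsubC; congr (_ * _.[_]).
  by apply: eq_bigr => i _; rewrite map_polyXsubC.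
rewrite rmorphD rmorphM /= hornerD hornerM !horner_half map_polyX hornerX.
have Imu : complex.Im u = complex.Re t * complex.Im t *+ 2.
  by rewrite /u expr2; case: (t) => x y /=; rewrite mulr2n [y * x]mulrC.
have [u0|u0] := eqVneq (complex.Im u) 0; last first.
  have uN f : u != f%:C.
    by apply: contra u0 => /eqP ->.
  rewrite (@partial_fractions _ m (fun i => (e i)%:C) (fun i => (o i)%:C)) //; last first.
    by move=> i j /complexI/o_inj.
  set P := \prod_i _; set S := \sum_k _.
  have P0 : P != 0 by apply/prodf_neq0 => i _; rewrite subr_eq0.
  have [T T0 ST] : exists2 T, 0 <= T & complex.Im S = complex.Im u * T.
    rewrite /S; elim/big_ind: _ => [|S1 S2 [T1 T10 S1E] [T2 T20 S2E]|k _].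
    - by exists 0; rewrite // mulr0.
    - by exists (T1 + T2); rewrite ?addr_ge0 // raddfD /= S1E S2E mulrDr.
    - have ->: residue (fun i => (e i)%:C) (fun i => (o i)%:C) k = (residue e o k)%:C.
        rewrite /residue -[RHS]/(real_complex R _) fmorph_div !rmorph_prod.
        by congr (_ / _); apply: eq_bigr => i _; rewrite rmorphB.
      have [T T0 ->] := Im_simple_fraction (residue e o k) (uN (o k)).
      exists (- residue e o k * T); last by ring.
      by rewrite mulr_ge0 ?ltW // oppr_gt0 residue_lt0.
  have ->: a%:C * (P * (1 + S)) + b%:C * P * t = P * (a%:C * (1 + S) + b%:C * t).
    by ring.
  rewrite mulf_neq0 //.
  apply/eqP => /(congr1 (@complex.Im R)).
  have ImM c w : complex.Im (c%:C * w) = c * complex.Im w.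
    by case: w => x y; rewrite /= mul0r addr0.
  rewrite !raddfD /= !ImM !raddfD /= add0r ST Imu; apply/eqP.
  have [x0 y0] : complex.Re t != 0 /\ complex.Im t != 0.
    by apply/andP; move: u0; rewrite Imu mulrn_eq0 /= mulf_eq0 negb_or.
  rewrite (_ : _ + _ = complex.Im t * (a * complex.Re t * T *+ 2 + b)); last by ring.
  by rewrite mulf_neq0 // gt_eqF // ltr_wpDl // mulrn_wge0 // !mulr_ge0 // ltW.
have uE : u = (complex.Re u)%:C by case: (u) u0 => ? ? /= ->.
have horner_real (f : 'I_m -> R) :
    \prod_i (u - (f i)%:C) = (\prod_i (complex.Re u - f i))%:C.
  rewrite -[RHS]/(real_complex R _) rmorph_prod; apply: eq_bigr => i _.
  by rewrite uE rmorphB.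
rewrite !horner_real -!rmorphM.
have Reu : complex.Re u = complex.Re t ^+ 2 - complex.Im t ^+ 2.
  by rewrite /u expr2; case: (t) => x y /=; rewrite !expr2.
have ReM c w : complex.Re (c%:C * w) = c * complex.Re w.
  by case: w => x y; rewrite /= mul0r subr0.
have ImM c w : complex.Im (c%:C * w) = c * complex.Im w.
  by case: w => x y; rewrite /= mul0r addr0.
rewrite eq_complex raddfD raddfD /= ReM ImM add0r negb_and.
have [y0|y0] := eqVneq (complex.Im t) 0.
  have prod0 (f : 'I_m -> R) : (forall i, f i < 0) ->
      0 < \prod_i (complex.Re u - f i).
    move=> f0; apply: prodr_gt0 => i _; rewrite subr_gt0 (lt_le_trans (f0 i)) //.
    by rewrite Reu y0 expr0n subr0 sqr_ge0.
  by rewrite gt_eqF // ltr_pwDl ?mulr_ge0 ?mulr_gt0 ?prod0 // ltW // prod0.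
have x0 : complex.Re t = 0.
  by move/eqP: u0; rewrite Imu mulrn_eq0 /= mulf_eq0 (negPf y0) orbF => /eqP.
rewrite x0 mulr0 addr0 -negb_and !mulf_eq0 (negPf y0) orbF.
rewrite (gt_eqF a0) (gt_eqF b0) /=; apply/negP => /andP[].
move=> /prodf_eq0[i _ /eqP/subr0_eq ei] /prodf_eq0[j _ /eqP/subr0_eq oj].
by move: (eNo i j); rewrite -ei -oj eqxx.
Qed.

(** There are m sign changes of E and m sign changes of O on disjoint
intervals, and E and O have degree m: so these intervals locate all the roots
of E and O, and the order of the intervals is the interlacing. *)
Lemma stable_sign_changes m (E O : {poly R}) (c : nat -> R) :
  size E = m.+1 -> size O = m.+1 -> 0 < lead_coef E -> 0 < lead_coef O ->
  c 0 <= 0 ->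
  (forall k, (k < m.*2)%N -> c k.+1 < c k) ->
  (forall k, (k < m.*2)%N ->
     let P := if odd k then O else E in P.[c k] * P.[c k.+1] < 0) ->
  stable (E \Po 'X^2 + (O \Po 'X^2) * 'X).
Proof.
move=> szE szO lE lO c0 cdec csgn.
have cle i j : (i <= j <= m.*2)%N -> c j <= c i.
  case/andP; elim: j => [|j IH]; first by rewrite leqn0 => /eqP->.
  rewrite leq_eqVlt => /predU1P[-> //|ij jm].
  by apply: le_trans (IH ij (ltnW jm)); apply/ltW/cdec.
have root_between k : (k < m.*2)%N ->
    exists x, [&& c k.+1 < x, x < c k & root (if odd k then O else E) x].
  move=> km; have /= := csgn k km; set P := if _ then _ else _ => Pc.
  have lek := ltW (cdec k km).
  have [x /andP[xge xle] Px] : exists2 x, c k.+1 <= x <= c k & root P x.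
    have [Pk|Pk] := ltP P.[c k] 0.
      have [|x xI xP] := @poly_ivt R (- P) _ _ lek.
        by rewrite !hornerN oppr_le0 oppr_ge0 (ltW Pk) andbT ltW // -(nmulr_rlt0 _ Pk).
      by exists x => //; rewrite -rootN.
    have Pk0 : 0 < P.[c k].
      by rewrite lt_neqAle Pk andbT; apply: contraTneq Pc => <-; rewrite mul0r ltxx.
    by apply: poly_ivt => //; rewrite Pk andbT ltW // -(pmulr_rlt0 _ Pk0).
  exists x; rewrite Px andbT !lt_neqAle xge xle !andbT.
  by apply/andP; split; apply: contraTneq Pc => xE;
    move/rootP: Px; rewrite ?xE -?xE => ->; rewrite ?mulr0 ?mul0r ltxx.
have lt2 (i : 'I_m) : (i.*2.+1 < m.*2)%N by rewrite -doubleS leq_double ltn_ord.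
have /fin_all_exists[e eP] (i : 'I_m) : exists x,
    [&& c i.*2.+1 < x, x < c i.*2 & root E x].
  by have := root_between i.*2 (ltnW (lt2 i)); rewrite odd_double.
have /fin_all_exists[o oP] (i : 'I_m) : exists x,
    [&& c i.*2.+2 < x, x < c i.*2.+1 & root O x].
  by have := root_between i.*2.+1 (lt2 i); rewrite /= odd_double.
have oe (i j : 'I_m) : (i <= j)%N -> o j < e i.
  move=> ij; have /and3P[_ oj _] := oP j; have /and3P[ei _ _] := eP i.
  apply: lt_trans oj (le_lt_trans _ ei).
  by apply: cle; rewrite ltnS leq_double ij ltnW.
have eo (i j : 'I_m) : (i < j)%N -> e j < o i.
  move=> ij; have /and3P[_ ej _] := eP j; have /and3P[oi _ _] := oP i.
  apply: lt_trans ej (le_lt_trans _ oi).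
  by apply: cle; rewrite -doubleS leq_double ij ltnW // ltnW.
have factor (P : {poly R}) (f : 'I_m -> R) : injective f -> size P = m.+1 ->
    (forall i, root P (f i)) -> P = lead_coef P *: \prod_i ('X - (f i)%:P).
  move=> f_inj szP rP.
  rewrite {1}(@all_roots_prod_XsubC _ P [seq f i | i <- enum 'I_m]).
  - by rewrite big_map big_enum.
  - by rewrite size_map size_enum_ord.
  - by apply/allP => _ /mapP[i _ ->].
  - by rewrite uniq_rootsE map_inj_uniq ?enum_uniq.
have e_inj : injective e.
  move=> i j eij; apply: val_inj; case: (ltngtP i j) => // ij.
    by have := lt_trans (eo _ _ ij) (oe _ _ (leqnn i)); rewrite eij ltxx.
  by have := lt_trans (eo _ _ ij) (oe _ _ (leqnn j)); rewrite eij ltxx.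
have o_inj : injective o.
  move=> i j oij; apply: val_inj; case: (ltngtP i j) => // ij.
    by have := lt_trans (oe _ _ (leqnn j)) (eo _ _ ij); rewrite oij ltxx.
  by have := lt_trans (oe _ _ (leqnn i)) (eo _ _ ij); rewrite oij ltxx.
rewrite (factor E e) // => [|i]; last by have /and3P[] := eP i.
rewrite (factor O o) // => [|i]; last by have /and3P[] := oP i.
apply: stable_interlacing => // i.
have /and3P[_ ei _] := eP i; apply: lt_le_trans ei (le_trans _ c0).
by apply: cle; rewrite leq0n leq_double ltnW.
Qed.

End HermiteBiehler.

(** * A stability test in integer arithmetic *)

Definition halves (T : Type) (l : seq T) : seq T * seq T :=
  foldr (fun a eo => (a :: eo.2, eo.1)) ([::], [::]) l.

Lemma Poly_halves (R : comNzRingType) (l : seq R) :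
  Poly l = Poly (halves l).1 \Po 'X^2 + (Poly (halves l).2 \Po 'X^2) * 'X.
Proof.
elim: l => [|a l IH] /=; first by rewrite !comp_poly0 mul0r addr0.
rewrite !cons_poly_def IH comp_polyD comp_polyM comp_polyX comp_polyC.
by rewrite exprS expr1; ring.
Qed.

Lemma halves_map (T U : Type) (f : T -> U) (l : seq T) :
  halves (map f l) = (map f (halves l).1, map f (halves l).2).
Proof. by elim: l => //= a l ->. Qed.

(** The first component is the homogenized value d^(size l - 1) p(n / d), where
p has coefficients l, so that its sign is that of p(n / d); the second one is
the power of d that the next coefficient has to be multiplied with. *)
Definition horner_frac (n d : Z) (l : seq Z) : Z * Z :=
  foldr (fun c v => (Z.add (Z.mul c v.2) (Z.mul n v.1), Z.mul d v.2)) (Z0, Zpos xH)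
    l.

Definition opposite_signs (a b : Z) : bool :=
  Z.ltb a Z0 && Z.ltb Z0 b || Z.ltb Z0 a && Z.ltb b Z0.

(** E and O are exchanged at each step, so that their sign changes alternate
along the nodes -n/d. *)
Fixpoint alternating (E O : seq Z) (d n : Z) (ns : seq Z) : bool :=
  if ns is n' :: ns' then
    [&& Z.ltb n n',
        opposite_signs (horner_frac (Z.opp n) d E).1 (horner_frac (Z.opp n') d E).1
      & alternating O E d n' ns']
  else true.

(** The nodes of the test are 0 and the numbers -n/d for n in ns.  As
E and O have the same degree, only polynomials of odd degree can pass it. *)
Definition stability_test (l : seq Z) (d : Z) (ns : seq Z) : bool :=
  let E := (halves l).1 in let O := (halves l).2 in
  [&& size E == (size ns)./2.+1, size O == (size ns)./2.+1,
      ~~ odd (size ns), Z.ltb Z0 (last Z0 E), Z.ltb Z0 (last Z0 O), Z.ltb Z0 d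
    & alternating E O d Z0 ns].

Fixpoint add_coefs (a b : seq Z) : seq Z :=
  match a, b with
  | [::], _ => b
  | _, [::] => a
  | c :: a', d :: b' => Z.add c d :: add_coefs a' b'
  end.

Definition scale_coefs (c : Z) : seq Z -> seq Z := map (Z.mul c).

(** The denominator k of delta = n / k is cleared, to stay in the integers. *)
Definition closed_loop (k n : Z) (x y : seq Z) : seq Z :=
  add_coefs (scale_coefs k (add_coefs [:: Z0, Z0 & x] x))
    (add_coefs (scale_coefs (Z.mul (-2)%bZ n) (Z0 :: x))
       (scale_coefs k (add_coefs [:: Z0, Z0 & y] (scale_coefs (-1)%bZ y)))).

Section ZtoR.
Variable R : realType.

Definition ZtoR (z : Z) : R := (int_of_Z z)%:~R.

Lemma ZtoRD : {morph ZtoR : x y / Z.add x y >-> x + y}.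
Proof. by move=> x y; rewrite /ZtoR (rmorphD int_of_Z) rmorphD. Qed.

Lemma ZtoRM : {morph ZtoR : x y / Z.mul x y >-> x * y}.
Proof. by move=> x y; rewrite /ZtoR (rmorphM int_of_Z) rmorphM. Qed.

Lemma ZtoRN : {morph ZtoR : x / Z.opp x >-> - x}.
Proof. by move=> x; rewrite /ZtoR (rmorphN int_of_Z) rmorphN. Qed.

Lemma ZtoR_lt (x y : Z) : Z.ltb x y -> ZtoR x < ZtoR y.
Proof. by rewrite /ZtoR ltr_int; lia. Qed.

Lemma ZtoR_opposite_signs (a b : Z) : opposite_signs a b -> ZtoR a * ZtoR b < 0.
Proof.
by case/orP=> /andP[/ZtoR_lt a0 /ZtoR_lt b0]; [rewrite nmulr_rlt0 | rewrite pmulr_rlt0].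
Qed.

Definition ZtoPoly (l : seq Z) : {poly R} := Poly (map ZtoR l).

Lemma horner_fracE (n d : Z) (l : seq Z) : ZtoR d != 0 ->
  ZtoR (horner_frac n d l).2 = ZtoR d ^+ size l /\
  ZtoR (horner_frac n d l).1 * ZtoR d
    = (ZtoPoly l).[ZtoR n / ZtoR d] * ZtoR d ^+ size l.
Proof.
move=> d0; rewrite /ZtoPoly; elim: l => [|c l [IH2 IH1]] /=.
  by rewrite horner0 !mul0r expr0.
split; first by rewrite ZtoRM IH2 exprS.
rewrite ZtoRD !ZtoRM IH2 horner_cons mulrDl -[ZtoR n * _ * _]mulrA IH1 exprS.
by field.
Qed.

Lemma alternatingP (E O : seq Z) (d n : Z) (ns : seq Z) (k : nat) :
  alternating E O d n ns -> (k < size ns)%N ->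
  let c j := - ZtoR (nth Z0 (n :: ns) j) / ZtoR d in
  let P := if odd k then O else E in
  0 < ZtoR d -> c k.+1 < c k /\ (ZtoPoly P).[c k] * (ZtoPoly P).[c k.+1] < 0.
Proof.
move=> + + c P d0.
rewrite {}/c {}/P; elim: ns E O n k => // n' ns IH E O n [|k] /= /and3P[nn' EE alt].
  move=> _; split; first by rewrite ltr_pM2r ?invr_gt0 // ltrN2 ZtoR_lt.
  have [_ En] := horner_fracE (Z.opp n) E (lt0r_neq0 d0).
  have [_ En'] := horner_fracE (Z.opp n') E (lt0r_neq0 d0).
  have := ZtoR_opposite_signs EE.
  rewrite -(pmulr_llt0 _ (mulr_gt0 d0 d0)) mulrACA En En' mulrACA !ZtoRN.
  by rewrite pmulr_llt0 // mulr_gt0 // exprn_gt0.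
rewrite ltnS => kns; have := IH _ _ _ _ alt kns; case: (odd k) => /=; exact.
Qed.

Lemma size_ZtoPoly (l : seq Z) : Z.ltb Z0 (last Z0 l) ->
  size (ZtoPoly l) = size l /\ 0 < lead_coef (ZtoPoly l).
Proof.
move=> /ZtoR_lt l0; have lastE : last 0 (map ZtoR l) = ZtoR (last Z0 l).
  by rewrite -[0]/(ZtoR Z0) last_map.
have lE : polyseq (ZtoPoly l) = map ZtoR l.
  by rewrite (PolyK (c := 0)) // lastE gt_eqF.
by split; rewrite ?lead_coefE lE ?size_map // -(size_map ZtoR) nth_last lastE.
Qed.

Lemma stability_testP (l : seq Z) (d : Z) (ns : seq Z) :
  stability_test l d ns -> stable (ZtoPoly l).
Proof.
case/and5P=> /eqP szE /eqP szO evn lE /and3P[lO d0 alt].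
have [sE lcE] := size_ZtoPoly lE; have [sO lcO] := size_ZtoPoly lO.
rewrite {1}/ZtoPoly Poly_halves halves_map /=.
have ns2 : ((size ns)./2).*2 = size ns by rewrite even_halfK.
apply: (@stable_sign_changes R (size ns)./2 _ _
  (fun j => - ZtoR (nth Z0 (Z0 :: ns) j) / ZtoR d)) => //.
- by rewrite sE.
- by rewrite sO.
- by rewrite /= /ZtoR oppr0 mul0r.
- by move=> k; rewrite ns2 => kn; have [] := alternatingP alt kn (ZtoR_lt d0).
- move=> k; rewrite ns2 => kn; have [_] := alternatingP alt kn (ZtoR_lt d0).
  by case: (odd k).
Qed.

Lemma coef_ZtoPoly_ge0 (l : seq Z) : all (Z.ltb Z0) l ->
  forall j, 0 <= (ZtoPoly l)`_j.
Proof.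
move=> /allP l0 j; rewrite coef_Poly.
have [jl|lj] := ltnP j (size l); last by rewrite nth_default ?size_map.
rewrite (nth_map Z0) //; apply: ltW.
by have := ZtoR_lt (l0 _ (mem_nth Z0 jl)); rewrite -[ZtoR Z0]/0.
Qed.

Lemma ZtoPoly_cons c l : ZtoPoly (c :: l) = ZtoPoly l * 'X + (ZtoR c)%:P.
Proof. by rewrite /ZtoPoly /= cons_poly_def. Qed.

Lemma ZtoPoly_add a b : ZtoPoly (add_coefs a b) = ZtoPoly a + ZtoPoly b.
Proof.
elim: a b => [|c a IH] [|d b]; rewrite /= ?ZtoPoly_cons ?IH ?ZtoRD ?polyCD.
- by rewrite /ZtoPoly /= addr0.
- by rewrite /ZtoPoly /= add0r.
- by rewrite /ZtoPoly /= addr0.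
- by ring.
Qed.

Lemma ZtoPoly_scale c l : ZtoPoly (scale_coefs c l) = ZtoR c *: ZtoPoly l.
Proof.
elim: l => [|a l IH]; first by rewrite /ZtoPoly /= scaler0.
by rewrite /= !ZtoPoly_cons IH ZtoRM scalerDr -scalerAl -[_ *: (_)%:P]mul_polyC polyCM.
Qed.

Lemma closed_loopE (k n : Z) (delta : R) (x y : seq Z) :
  ZtoR k * delta = ZtoR n ->
  ZtoPoly (closed_loop k n x y) =
    ZtoR k *: (('X^2 - (2 * delta) *: 'X + 1) * ZtoPoly x
               + ('X^2 - 1) * ZtoPoly y).
Proof.
move=> kd; rewrite /closed_loop !(ZtoPoly_add, ZtoPoly_scale, ZtoPoly_cons).
rewrite ZtoRM -kd.
have ->: ZtoR (-2)%bZ = - 2 by rewrite /ZtoR; ring.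
have ->: ZtoR (-1)%bZ = - 1 by rewrite /ZtoR; ring.
have ->: ZtoR Z0 = 0 by rewrite /ZtoR.
by rewrite -!mul_polyC !polyCM !polyCN; ring.
Qed.

End ZtoR.

(** * The Moebius substitution *)

Section Moebius.
Variable R : realType.
Local Open Scope complex_scope.
Local Notation eval p t := (map_poly (real_complex R) p).[t].

Lemma size_linear_exp (a b : R) n : (size ((a *: 'X + b%:P) ^+ n) <= n.+1)%N.
Proof.
have szl : (size (a *: 'X + b%:P)%R <= 2)%N.
  apply: leq_trans (size_polyD _ _) _; rewrite geq_max size_polyC.
  by rewrite (leq_trans (size_scale_leq _ _)) ?size_polyX //; case: (b == 0).
have := size_poly_exp_leq (a *: 'X + b%:P) n.
by move=> /leq_trans; apply; rewrite ltnS; move: szl; nia.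
Qed.

Lemma coef_top_mul (p q : {poly R}) m n :
  (size p <= m.+1)%N -> (size q <= n.+1)%N -> (p * q)`_(m + n) = p`_m * q`_n.
Proof.
move=> szp szq; have mlt : (m < (m + n).+1)%N by rewrite ltnS leq_addr.
rewrite coefM (bigD1 (Ordinal mlt)) //= addKn big1 ?addr0 // => i im.
have [mi|] := ltnP m i; first by rewrite nth_default ?mul0r // (leq_trans szp).
rewrite leq_eqVlt => /predU1P[ie|ltim].
  by rewrite -val_eqE /= ie eqxx in im.
by rewrite [q`__]nth_default ?mulr0 // (leq_trans szq) //; move: ltim; lia.
Qed.

Lemma coef_linear_exp (a b : R) n : ((a *: 'X + b%:P) ^+ n)`_n = a ^+ n.
Proof.
elim: n => [|n IH]; first by rewrite !expr0 coef1.
rewrite exprS -(add1n n) coef_top_mul ?size_linear_exp //; last first.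
  by rewrite -[_ + _]expr1 size_linear_exp.
by rewrite IH coefD coefZ coefX coefC mulr1 addr0 exprS.
Qed.

(** The polynomial (b s + a)^n p((a s + b) / (b s + a)), for n at least the
degree of p. *)
Definition mobius (a b : R) (n : nat) (p : {poly R}) : {poly R} :=
  \sum_(j < n.+1)
    p`_j *: ((a *: 'X + b%:P) ^+ j * (b *: 'X + a%:P) ^+ (n - j)).

Lemma size_mobius (a b : R) n p : (size (mobius a b n p) <= n.+1)%N.
Proof.
apply: leq_trans (size_sum _ _ _) _; apply/bigmax_leqP => j _.
apply: leq_trans (size_scale_leq _ _) _.
apply: leq_trans (size_polyMleq _ _) _.
have := size_linear_exp a b j; have := size_linear_exp b a (n - j).
have := ltn_ord j; lia.
Qed.

Lemma coef_mobius (a b : R) n p :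
  (mobius a b n p)`_n = \sum_(j < n.+1) p`_j * (a ^+ j * b ^+ (n - j)).
Proof.
rewrite coef_sum; apply: eq_bigr => j _; rewrite coefZ; congr (_ * _).
have jn : (j <= n)%N by rewrite -ltnS.
have := coef_top_mul (size_linear_exp a b j) (size_linear_exp b a (n - j)).
by rewrite subnKC // !coef_linear_exp.
Qed.

Lemma eval_mobius (a b : R) n (p : {poly R}) (t : R[i]) :
  (size p <= n.+1)%N -> b%:C * t + a%:C != 0 ->
  eval (mobius a b n p) t =
    (b%:C * t + a%:C) ^+ n * eval p ((a%:C * t + b%:C) / (b%:C * t + a%:C)).
Proof.
move=> szp den0.
have evlin (c d : R) : eval (c *: 'X + d%:P) t = c%:C * t + d%:C.
  by rewrite rmorphD /= map_polyZ map_polyX map_polyC /= !hornerE.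
rewrite rmorph_sum horner_sum (@horner_coef_wide _ n.+1); last first.
  by rewrite (leq_trans _ szp) // size_map_poly.
rewrite mulr_sumr; apply: eq_bigr => j _.
have jn : (j <= n)%N by rewrite -ltnS.
rewrite /= map_polyZ rmorphM !rmorphXn /= hornerZ hornerM !horner_exp !evlin.
have := exprD (b%:C * t + a%:C) j (n - j); rewrite subnKC // => ->.
rewrite coef_map /= expr_div_n.
by field; rewrite expf_neq0.
Qed.

Lemma mobius_half_plane (a b : R) (t : R[i]) :
  0 < a -> 0 <= b -> 0 <= complex.Re t ->
  b%:C * t + a%:C != 0 /\
  0 <= complex.Re ((a%:C * t + b%:C) / (b%:C * t + a%:C)).
Proof.
case: t => x y a0 b0 /= x0.
have den0 : 0 < b * x + a by rewrite ltr_wpDl // mulr_ge0.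
split; first by rewrite eq_complex /= negb_and mul0r subr0 gt_eqF.
simpc; rewrite /= (_ : _ + _ = ((a * x + b) * (b * x + a) + a * b * y ^+ 2)
  / ((b * x + a) ^+ 2 + (b * y) ^+ 2)); last by ring.
have ax0 : 0 <= a * x + b by rewrite addr_ge0 // mulr_ge0 // ltW.
apply: divr_ge0; last by rewrite addr_ge0 ?sqr_ge0.
by apply: addr_ge0; apply: mulr_ge0; rewrite ?sqr_ge0 ?mulr_ge0 // ltW.
Qed.

Lemma stableZ (c : R) (p : {poly R}) :
  c != 0 -> stable (c *: p) <-> stable p.
Proof.
move=> c0; suff rootE t : root (map_poly (real_complex R) (c *: p)) t
    = root (map_poly (real_complex R) p) t.
  by split=> sp t; [rewrite -rootE | rewrite rootE]; apply: sp.
by rewrite map_polyZ rootZ // fmorph_eq0.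
Qed.

Lemma stable_mobius (a b : R) n (p : {poly R}) :
  0 < a -> 0 <= b -> (size p <= n.+1)%N -> stable p -> stable (mobius a b n p).
Proof.
move=> a0 b0 szp sp; apply: stableP => t /(mobius_half_plane a0 b0)[den0 w0].
by rewrite eval_mobius // mulf_neq0 ?expf_neq0 // stableN0.
Qed.

Lemma eval_closed_loop (delta : R) (x y : {poly R}) (t : R[i]) :
  eval (('X^2 - (2 * delta) *: 'X + 1) * x + ('X^2 - 1) * y) t
  = (t ^+ 2 - 2 * delta%:C * t + 1) * eval x t + (t ^+ 2 - 1) * eval y t.
Proof.
rewrite !(rmorphD, rmorphM, rmorphN, rmorph1) /= map_polyZ map_polyX.
by rewrite !hornerE /= rmorphM rmorph_nat !expr2.
Qed.

(** The substitution with a = 1 + r and b = 1 - r turns delta0 into delta when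
r^2 is the quantity q of the proof, and q <= 1 amounts to delta <= delta0.
Nonnegative coefficients ensure that x keeps its degree under the
substitution. *)
Lemma admissible_le (delta0 delta : R) n (x y : {poly R}) :
  -1 < delta -> delta <= delta0 -> delta0 < 1 ->
  size x = n.+1 -> (size y <= n.+1)%N -> (forall j, 0 <= x`_j) ->
  stable x -> stable y ->
  stable (('X^2 - (2 * delta0) *: 'X + 1) * x + ('X^2 - 1) * y) ->
  admissible delta.
Proof.
move=> dN1 dd0 d01 szx szy x0 sx sy sz.
pose q := (1 + delta) * (1 - delta0) / ((1 - delta) * (1 + delta0)).
have den_gt0 : 0 < (1 - delta) * (1 + delta0) by apply: mulr_gt0; lra.
have q0 : 0 < q by apply: divr_gt0 => //; apply: mulr_gt0; lra.
have q1 : q <= 1 by rewrite ler_pdivrMr // mul1r; nra.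
pose r := Num.sqrt q; have r0 : 0 < r by rewrite sqrtr_gt0.
have r2 : r ^+ 2 = q by rewrite sqr_sqrtr // ltW.
have r1 : r <= 1 by rewrite -sqrtr1 ler_sqrt.
pose a := 1 + r; pose b := 1 - r.
have a0 : 0 < a by rewrite addr_gt0.
have b0 : 0 <= b by rewrite subr_ge0.
pose k := a ^+ 2 + b ^+ 2 - 2 * delta0 * (a * b).
have kE : k = 2 * ((1 + q) - delta0 * (1 - q)).
  by rewrite /k /a /b -r2; ring.
have k0 : 0 < k by rewrite kE; nra.
have kd : k * delta = delta0 * (a ^+ 2 + b ^+ 2) - 2 * (a * b).
  have -> : delta0 * (a ^+ 2 + b ^+ 2) - 2 * (a * b)
      = 2 * (delta0 * (1 + q) - (1 - q)) by rewrite /a /b -r2; ring.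
  rewrite kE /q; field; apply/andP; split; rewrite gt_eqF //; lra.
have ab0 : 0 < a ^+ 2 - b ^+ 2.
  by rewrite (_ : _ - _ = 4 * r) ?mulr_gt0 // /a /b; ring.
have xn0 : 0 < x`_n.
  rewrite lt_neqAle x0 eq_sym andbT.
  by have := stable_neq0 sx; rewrite -lead_coef_eq0 lead_coefE szx.
exists (k *: mobius a b n x), ((a ^+ 2 - b ^+ 2) *: mobius a b n y); split.
- by apply/stableZ; rewrite ?gt_eqF //; apply: stable_mobius; rewrite ?szx.
- by apply/stableZ; rewrite ?gt_eqF //; apply: stable_mobius.
- rewrite !size_scale ?gt_eqF //.
  apply: leq_trans (size_mobius _ _ _ _) _.
  rewrite ltnNge; apply/negP => /(nth_default 0)/eqP; apply/negP.
  rewrite coef_mobius gt_eqF // big_ord_recr /= subnn expr0 mulr1.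
  rewrite ltr_wpDl ?mulr_gt0 ?exprn_gt0 //.
  apply: sumr_ge0 => j _; rewrite mulr_ge0 // mulr_ge0 // exprn_ge0 //.
  exact: ltW.
apply: stableP => t /(mobius_half_plane a0 b0)[]; rewrite eval_closed_loop.
set w := _ / _; set h := b%:C * t + a%:C => h0 w0.
rewrite !map_polyZ !hornerZ !eval_mobius ?szx // -/h -/w.
have kC : k%:C = a%:C ^+ 2 + b%:C ^+ 2 - 2 * delta0%:C * (a%:C * b%:C).
  by rewrite /k; ring.
have kdC : k%:C * delta%:C
    = delta0%:C * (a%:C ^+ 2 + b%:C ^+ 2) - 2 * (a%:C * b%:C).
  by rewrite -rmorphM kd; ring.
have abC : (a ^+ 2 - b ^+ 2)%:C = a%:C ^+ 2 - b%:C ^+ 2.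
  by ring.
have wh : w * h = a%:C * t + b%:C by rewrite /w divfK.
have pE : (t ^+ 2 - 2 * delta%:C * t + 1) * k%:C
    = h ^+ 2 * (w ^+ 2 - 2 * delta0%:C * w + 1).
  transitivity (k%:C * (t ^+ 2 + 1) - 2 * (k%:C * delta%:C) * t); first by ring.
  transitivity ((w * h) ^+ 2 - 2 * delta0%:C * (w * h) * h + h ^+ 2); last by ring.
  by rewrite kdC kC wh /h; ring.
have qE : (t ^+ 2 - 1) * (a ^+ 2 - b ^+ 2)%:C = h ^+ 2 * (w ^+ 2 - 1).
  transitivity ((w * h) ^+ 2 - h ^+ 2); last by ring.
  by rewrite abC wh /h; ring.
rewrite !mulrA pE qE.
have := stableN0 sz w0; rewrite eval_closed_loop => sw.
rewrite (_ : _ + _ = h ^+ n.+2 * ((w ^+ 2 - 2 * delta0%:C * w + 1) * eval x w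
  + (w ^+ 2 - 1) * eval y w)); last by rewrite !exprS; ring.
by rewrite mulf_neq0 ?expf_neq0.
Qed.

Lemma stable_quadratic (a b c : R) : 0 < a -> 0 < b -> 0 < c ->
  stable (a *: 'X^2 + b *: 'X + c%:P).
Proof.
move=> a0 b0 c0; apply: stableP => t t0.
rewrite !rmorphD /= !map_polyZ map_polyXn map_polyX map_polyC /= !hornerE.
case: t t0 => x y /= x0; rewrite eq_complex /= negb_and.
have [->|y0] := eqVneq y 0.
  by apply/orP; left; rewrite gt_eqF //; nra.
apply/orP; right; rewrite (_ : _ + _ = y * (2 * a * x + b)); last by ring.
by rewrite mulf_neq0 // gt_eqF //; nra.
Qed.

Lemma admissible_neg (delta : R) : delta < 0 -> admissible delta.
Proof.
move=> d0; have two0 : (2 : R) != 0 by rewrite pnatr_eq0.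
exists 2%:P, 1%:P; split; rewrite ?size_polyC ?oner_eq0 ?two0 //.
- exact: stableC.
- by apply: stableC; rewrite oner_eq0.
rewrite (_ : _ + _ = 3 *: 'X^2 + (- 4 * delta) *: 'X + 1%:P).
  by apply: stable_quadratic; lra.
by rewrite -!mul_polyC; ring.
Qed.

End Moebius.

(** * The pair of polynomials for delta0 *)

(** The constant terms of x and y differ by one unit only: their difference
gives z(0), and many roots of z cluster near 0. *)
Definition x_coefs : seq Z :=
  [:: 8634295062443806; 41570892277097112; 369739675289881485;
      1406033151329201960; 6522046320043076659; 19994718889260709979;
      63061688505154775988; 157614959076218872901;
      373646569228338237105; 765812402407381248469;
      1434831803426200556982; 2419512580152977070188;
      3685956781577720547601; 5129341338851622438383;
      6459810623867348728996; 7446032225765886369529;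
      7818860768506230552605; 7488046857474485487851;
      6568169760814239477057; 5231206016650587311181;
      3814398726143716068106; 2521042130254141221834;
      1509557498604100952114; 822965383552859024051;
      396388780907319086783; 176316902496185033518;
      66277053430217114393; 23623109393732728807; 6641796143790917039;
      1838000046708873890; 357524248843918127; 72374436228626687;
      7827209251442999; 1020099520939422]%bZ.

Definition y_coefs : seq Z :=
  [:: 8634295062443805; 24633258135670925; 305459909789906287;
      746930220811679512; 4439073415557220115; 9353582265344336807;
      34799776029045824724; 63257062878473116716; 162319558507645904602;
      253713292880886795963; 468526826061250242156;
      624370898284898509959; 843017573260822785004;
      942522117388612906142; 926201011184270396906;
      843898053583183670566; 588164177263299833441;
      413269444013502148456; 194799173651526019537;
      93962463572652891808; 28864779586289685181; 7556801693652067488;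
      1437644204187263736; 234052489838655926; 29150220732840592;
      3120465211399093; 258758517713190; 18206777843339; 977975327669;
      42867402292; 1359378262; 31855233; 455296; 3218]%bZ.

(** Numerators of squared frequencies omega^2, over 100 for x and y and over
10^4 for z.  They were chosen so that the argument of p(i omega) passes a
multiple of pi/2 exactly once between consecutive ones. *)
Definition x_nodes : seq Z :=
  [:: 10; 12; 14; 16; 18; 20; 23; 27; 30; 32; 40; 70; 100; 110; 113; 121; 130;
      140; 150; 153; 170; 180; 200; 300; 600; 630; 700; 800; 1000; 1200;
      2000; 10000]%bZ.

Definition y_nodes : seq Z :=
  [:: 10; 12; 15; 17; 20; 21; 23; 30; 43; 50; 52; 56; 60; 70; 100; 200; 230;
      300; 1000; 2000; 3000; 5000; 6000; 10000; 11000; 20000; 30000;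
      40000; 60000; 100000; 300000; 1000000]%bZ.

Definition z_nodes : seq Z :=
  [:: 3; 5; 10; 20; 40; 50; 60; 80; 100; 130; 160; 200; 240; 300; 400; 500;
      1000; 2000; 7000; 7400; 10000; 20000; 30000; 31000; 34000; 37000;
      40000; 50000; 60000; 80000; 100000; 110000; 200000; 1000000]%bZ.

Lemma x_test : stability_test x_coefs 100%bZ x_nodes.
Proof. by vm_compute. Qed.

Lemma y_test : stability_test y_coefs 100%bZ y_nodes.
Proof. by vm_compute. Qed.

Lemma z_test : stability_test
  (closed_loop 10000000%bZ 9808348%bZ x_coefs y_coefs) 10000%bZ z_nodes.
Proof. by vm_compute. Qed.

Theorem theorem5p1 (R : realType) (delta : R)
  (hdelta : delta <= 9808348%N%:R / 10 ^+ 7) : admissible delta.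
Proof.
have [/admissible_neg//|d0] := ltP delta 0.
set delta0 : R := _ / _ in hdelta.
have kE : ZtoR R 10000000%bZ = 10 ^+ 7 by rewrite /ZtoR; ring.
have nE : ZtoR R 9808348%bZ = 9808348%N%:R by rewrite /ZtoR; ring.
have k0 : 0 < 10 ^+ 7 :> R by rewrite exprn_gt0.
have zE := @closed_loopE R 10000000%bZ 9808348%bZ delta0 x_coefs y_coefs.
have sz := @stability_testP R _ _ _ z_test; rewrite {}zE in sz; last first.
  rewrite kE nE [_ * delta0]mulrC; apply: divfK; exact: lt0r_neq0 k0.
have [xl _] := @size_ZtoPoly R x_coefs isT.
have [yl _] := @size_ZtoPoly R y_coefs isT.
apply: (@admissible_le R delta0 delta 33 (ZtoPoly R x_coefs) (ZtoPoly R y_coefs)).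
- by apply: lt_le_trans d0; rewrite ltrN10.
- exact: hdelta.
- by rewrite /delta0 (ltr_pdivrMr _ _ k0) mul1r -nE -kE; exact: ZtoR_lt.
- by rewrite xl.
- by rewrite yl.
- exact: coef_ZtoPoly_ge0.
- exact: stability_testP x_test.
- exact: stability_testP y_test.
- by apply/(stableZ _ (lt0r_neq0 k0)); rewrite -kE.
Qed.
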